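(* Let $B$ be a finite Blaschke product of degree $n$ and $g\in H^\infty(\mathbb{D})$. The function $\Gamma(g)$ vanishes identically in the unit disk $\mathbb{D}$ if and only if there exist a function $\varphi$ from $\mathbb{D}$ to itself and a discrete subset $A$ of $\mathbb{D}$ such that $\#\varphi^{-1}(z)>1$ for every $z\in\mathbb{D}\setminus A$, and such that $B=B_1\circ\varphi$ and $g=g_1\circ\varphi$, where $B_1$ and $g_1$ are functions defined on $\mathbb{D}$.
   Context: $\mathbb{D}$ is the open unit disk. The Blaschke product is $B(z)=\prod_{j=1}^n\frac{a_j-z}{1-\bar a_j z}$ with $a_1,\dots,a_n\in\mathbb{D}$, $n\ge 2$. For $z\in\mathbb{D}$ there are exactly $n$ points of $\mathbb{D}$, counted with multiplicity, at which $B$ takes the value $B(z)$; they are denoted $z=\varphi_0(z),\varphi_1(z),\dots,\varphi_{n-1}(z)$. For $f$ holomorphic in $\mathbb{D}$, $\Gamma(f)$ is the holomorphic function on $\mathbb{D}$ given at points with $B'(z)\ne0$ by $\Gamma(f)(z)=\prod_{j=1}^{n-1}\frac{f(z)-f(\varphi_j(z))}{z-\varphi_j(z)}$ (the remaining singularities are removable). *)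

(* Defs.v *)
From HB Require Import structures.
From mathcomp Require Import all_boot all_order all_algebra.
From mathcomp Require Import all_classical all_reals all_analysis.
From mathcomp Require Import complex.

Set Implicit Arguments.
Unset Strict Implicit.
Unset Printing Implicit Defensive.

Import Order.TTheory GRing.Theory Num.Theory.
Import numFieldNormedType.Exports.

Local Open Scope classical_set_scope.
Local Open Scope ring_scope.

(* R[i] packed as a numClosedFieldType, so that it receives the generic
   norm and topology of number fields. *)
Definition Cplx (R : realType) : numClosedFieldType := R[i].

Section Definitions.
Variable C : numClosedFieldType.
Implicit Types (f h : C -> C) (z w u : C) (s : seq C).

Definition disk : set C := [set z | `|z| < 1].

Definition holomorphic (U : set C) f := forall z, U z -> derivable f z 1.

Definition Hinfty f :=
  holomorphic disk f /\ exists M : C, forall z, disk z -> `|f z| <= M.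

(* m = 0 means f w != 0. *)
Definition vanishing_order f w (m : nat) :=
  exists2 h : C -> C, h w != 0
    & \forall u \near w, derivable h u 1 /\ f u = (u - w) ^+ m * h u.

Definition discrete_subset (D A : set C) := A `<=` D /\ A `<=` isolated A.

Variables (n : nat) (a : 'I_n -> C).

Definition Blaschke z := \prod_(j < n) ((a j - z) / (1 - (a j)^* * z)).

(* s lists, with multiplicity and starting with z, the points of the disk at
   which Blaschke takes the value Blaschke z; there are n of them. *)
Definition fibre z s :=
  [/\ size s = n, nth 0 s 0 = z, (forall w, w \in s -> disk w)
    & forall w, disk w ->
        vanishing_order (fun u => Blaschke u - Blaschke z) w (count_mem w s)].

(* The ordering of the points after the first is chosen arbitrarily; every use
   below is symmetric in them. *)
Definition varphi (j : nat) z : C := nth 0 (xget [::] (fibre z)) j.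

Definition Gamma_prod f z :=
  \prod_(1 <= j < n) ((f z - f (varphi j z)) / (z - varphi j z)).

(* The critical points of Blaschke are isolated and Gamma_prod f is bounded
   near them: they are removable, and the value there is the limit. *)
Definition Gamma f z : C :=
  if derive1 Blaschke z != 0 then Gamma_prod f z
  else lim (Gamma_prod f w @[w --> z^']).

End Definitions.
Arguments disk {C}.

(* Main.v *)
Require Import Defs.
From HB Require Import structures.
From mathcomp Require Import all_boot all_order all_algebra.
From mathcomp Require Import all_classical all_reals all_analysis.
From mathcomp Require Import complex.
From mathcomp Require Import ring lra zify.

Set Implicit Arguments.
Unset Strict Implicit.
Unset Printing Implicit Defensive.

Import Order.TTheory GRing.Theory Num.Theory.
Import numFieldNormedType.Exports.

Local Open Scope classical_set_scope.
Local Open Scope ring_scope.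

(** The map phi of the statement is only required to be a function, so the
    equivalence says two things: which points of the disk share their values of
    B and g with another point, and how many classes the pair (B, g) has.

    Call another point of the disk with the same B and the same g a twin.  At a
    point z with B'(z) != 0 the point z occurs once in its fibre, so the
    varphi_j(z) with j >= 1 are exactly the other points of the fibre, and the
    product Gamma(g)(z) vanishes if and only if z has a twin
    (Gamma_noncritical).  This rests on the description of the fibres of B as the
    root sets of the polynomials p - c q, where B = p / q: for |c| < 1 such a
    polynomial has degree n and all its roots lie in the disk.  The critical
    points are the zeros in the disk of p' q - p q', which is a nonzero
    polynomial because p and q are coprime; so they are finitely many.

    If Gamma(g) = 0, all points with B' != 0 have twins, and the classes of the
    relation (B, g)(z) = (B, g)(w) that are singletons sit at critical points.
    Since B is injective near a point where B' != 0, there are as many classes as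
    points in the disk, so by the Cantor-Bernstein theorem some phi from the disk
    onto itself has precisely these classes as fibres; A is the image of the
    critical points (collapse_of_twins).

    Conversely, a discrete set A is countable, and so is its preimage by phi,
    because fibres of phi lie in fibres of B.  Hence all but countably many
    points have twins.  But having no twin is an open condition at a point z0
    with B'(z0) != 0 (separated_fibre_near): the fibre of B moves continuously,
    g separates z0 from the rest of its fibre, and B itself separates points
    close to z0.  A nonempty open set is uncountable, so every noncritical point
    has a twin, and Gamma(g) vanishes there; at the critical points Gamma(g) is
    a limit of zeros. *)

(** * Divided differences *)

Section DividedDifferences.
Variable C : numClosedFieldType.
Implicit Types (f k : C -> C) (p : {poly C}) (z : C).

(** Caratheodory's form of the derivative: no quotient appears, which suits both
    polynomials and functions with a prescribed order of vanishing. *)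
Lemma is_derive_divided_difference f k z :
  (\forall u \near z, f u - f z = (u - z) * k u) -> {for z, continuous k} ->
  is_derive z 1 f (k z).
Proof.
move=> fk ck.
have lim_k : h^-1 *: (f (h *: 1 + z) - f z) @[h --> 0^'] --> k z.
  have shift : h + z @[h --> (0 : C)^'] --> z.
    rewrite -[X in _ --> X]add0r.
    by apply: cvgD; [exact: cvg_within|exact: cvg_cst].
  have kshift : k (h + z) @[h --> (0 : C)^'] --> k z by exact: (cvg_comp _ _ shift ck).
  apply: cvg_trans kshift; apply: near_eq_cvg.
  have nz : \forall h \near (0 : C)^', h != 0 by exact: nbhs_dnbhs_neq.
  near=> h.
  have h0 : h != 0 by near: h.
  have -> : f (h *: 1 + z) - f z = (h + z - z) * k (h + z).
    rewrite [h *: 1]mulr1; near: h; exact: (shift _ fk).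
  by rewrite addrK [_ *: _]mulrA mulVf// mul1r.
split; first by apply/cvg_ex; exists (k z).
exact: cvg_lim lim_k.
Unshelve. all: by end_near. Qed.

Lemma horner_continuous p : continuous (horner p).
Proof.
elim/poly_ind: p => [|p c cp] z.
  have -> : horner (0 : {poly C}) = cst 0 by apply/funext => u; rewrite horner0.
  exact: cst_continuous.
have -> : horner (p * 'X + c%:P) = (horner p \* id) + cst c.
  by apply/funext => u; rewrite !hornerE.
apply: continuousD; last exact: cst_continuous.
by apply: continuousM; [exact: cp|exact: cvg_id].
Qed.

(** The two-variable quotient K is what gives injectivity near a point, where a
    derivative at that point alone would not: see Blaschke_locally_injective. *)
Lemma poly_divided_difference p : exists K : C -> C -> C,
  [/\ forall u v, p.[u] - p.[v] = (u - v) * K u v,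
      forall z, K z z = p^`().[z]
    & continuous (fun x : C * C => K x.1 x.2)].
Proof.
elim/poly_ind: p => [|p c [K [KE Kd Kc]]].
  exists (fun _ _ => 0); split=> [u v|z|].
  - by rewrite !horner0 mulr0 subrr.
  - by rewrite deriv0 horner0.
  - exact: cst_continuous.
(* p(u) u - p(v) v = (p(u) - p(v)) u + p(v) (u - v). *)
exists (fun u v => K u v * u + p.[v]); split=> [u v|z|x].
- rewrite !hornerE; have := KE u v; move: (K u v) (p.[u]) (p.[v]) => k pu pv e.
  have -> : pu = pv + (u - v) * k by rewrite -e addrC subrK.
  ring.
- by rewrite derivD derivM derivX derivC addr0 mulr1 hornerD hornerM hornerX Kd.
- have -> : (fun x : C * C => K x.1 x.2 * x.1 + p.[x.2]) =
      ((fun x => K x.1 x.2) \* fst) + (horner p \o snd) by exact/funext.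
  apply: continuousD; first by apply: continuousM; [exact: Kc|exact: cvg_fst].
  by apply: continuous_comp; [exact: cvg_snd|exact: horner_continuous].
Qed.

Lemma is_derive_horner p z : is_derive z 1 (horner p) p^`().[z].
Proof.
have [K [KE Kd Kc]] := poly_divided_difference p.
rewrite -Kd; apply: (is_derive_divided_difference (k := K^~ z)).
  by near=> u; exact: KE.
apply: (@continuous2_cvg _ C C C (nbhs z) _ id (cst z) K); first exact: (Kc (z, z)).
  exact: cvg_id.
exact: cvg_cst.
Unshelve. all: by end_near. Qed.

End DividedDifferences.

(** * Moebius factors *)

Section Mobius.
Variable C : numClosedFieldType.
Implicit Types a u z : C.

Lemma not_diskP z : ~ disk z <-> 1 <= `|z|.
Proof.
rewrite /disk /= real_ltNge ?normr_real ?real1 //.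
by split=> [/negP/negPn|h]; last by rewrite h.
Qed.

(** The sign of the right-hand side tells on which side of the unit circle u lies;
    all estimates on Blaschke products below come from this identity. *)
Lemma mobius_normE a u :
  `|1 - a^* * u| ^+ 2 - `|a - u| ^+ 2 = (1 - `|a| ^+ 2) * (1 - `|u| ^+ 2).
Proof. rewrite !normCK !rmorphB !rmorphM rmorph1 /= conjCK; ring. Qed.

Lemma mobius_denom_neq0 a u : disk a -> disk u -> 1 - a^* * u != 0.
Proof.
move=> a1 u1; rewrite subr_eq0 eq_sym; apply/eqP => /(congr1 Num.norm) au1.
have : `|a^* * u| < 1.
  rewrite normrM norm_conjC; apply: (le_lt_trans _ a1).
  by rewrite ler_piMr // ltW.
by rewrite au1 normr1 ltxx.
Qed.

Lemma mobius_lt1 a u : disk a -> disk u -> `|a - u| < `|1 - a^* * u|.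
Proof.
move=> a1 u1; rewrite -(@ltr_pXn2r _ 2) ?nnegrE // -subr_gt0 mobius_normE.
by rewrite mulr_gt0 // subr_gt0 expr_lt1.
Qed.

Lemma mobius_ge1 a u : disk a -> ~ disk u -> `|1 - a^* * u| <= `|a - u|.
Proof.
move=> a1 /not_diskP u1; rewrite -(@ler_pXn2r _ 2) ?nnegrE // -subr_le0.
rewrite mobius_normE mulr_ge0_le0 // ?subr_ge0 ?subr_le0 ?exprn_ege1 //.
by rewrite exprn_ile1 // ltW.
Qed.


End Mobius.

(** * Blaschke products as rational functions *)

Section LinearProduct.
Variable K : comNzRingType.

Lemma size_prod_linear n (f : 'I_n -> {poly K}) :
  (forall j, (size (f j) <= 2)%N) -> (size (\prod_(j < n) f j)%R <= n.+1)%N.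
Proof.
elim: n f => [|n IHn] f f2; first by rewrite big_ord0 size_poly1.
rewrite big_ord_recl; apply: (leq_trans (size_polyMleq _ _)).
have := IHn (fun j => f (lift ord0 j)) (fun j => f2 _).
by move: (f2 ord0); lia.
Qed.

Lemma coef_prod_linear n (f : 'I_n -> {poly K}) :
  (forall j, (size (f j) <= 2)%N) -> (\prod_(j < n) f j)`_n = \prod_(j < n) (f j)`_1.
Proof.
elim: n f => [|n IHn] f f2; first by rewrite !big_ord0 coef1.
rewrite !big_ord_recl -IHn //; set P := \prod_(i < n) _.
have sP : (size P <= n.+1)%N by exact: size_prod_linear.
rewrite coefM big_ord_recl big_ord_recl big1 /= => [|i _].
  by rewrite subn0 (nth_default _ sP) mulr0 add0r addr0 /bump /= subSS subn0.
by rewrite (nth_default _ (leq_trans (f2 ord0) _)) ?mul0r.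
Qed.

End LinearProduct.

Section BlaschkePolynomials.
Variables (C : numClosedFieldType) (n : nat) (a : 'I_n -> C).
Hypothesis n_gt0 : (0 < n)%N.
Hypothesis ha : forall j, disk (a j).
Implicit Types (c u w z : C).

Definition blaschke_num : {poly C} := \prod_(j < n) ((a j)%:P - 'X).
Definition blaschke_den : {poly C} := \prod_(j < n) (1 - (a j)^* *: 'X).
Local Notation p := blaschke_num.
Local Notation q := blaschke_den.
(** Its roots are the points where B takes the value c. *)
Definition fibre_poly c : {poly C} := p - c *: q.
(** The numerator of the derivative of B = p / q. *)
Definition blaschke_wronskian : {poly C} := p^`() * q - p * q^`().

Lemma horner_num z : p.[z] = \prod_(j < n) (a j - z).
Proof. by rewrite horner_prod; apply: eq_bigr => j _; rewrite !hornerE. Qed.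

Lemma horner_den z : q.[z] = \prod_(j < n) (1 - (a j)^* * z).
Proof. by rewrite horner_prod; apply: eq_bigr => j _; rewrite !hornerE. Qed.

Lemma Blaschke_hornerE z : Blaschke a z = p.[z] / q.[z].
Proof. by rewrite horner_num horner_den /Blaschke prodf_div. Qed.

Lemma den_neq0 z : disk z -> q.[z] != 0.
Proof.
by move=> z1; rewrite horner_den; apply/prodf_neq0 => j _; exact: mobius_denom_neq0.
Qed.

Lemma Blaschke_lt1 z : disk z -> `|Blaschke a z| < 1.
Proof.
move=> z1; rewrite /Blaschke normr_prod (bigD1 (Ordinal n_gt0)) //=.
have lt1 j : `|(a j - z) / (1 - (a j)^* * z)| < 1.
  rewrite normf_div ltr_pdivrMr ?mul1r ?normr_gt0 ?mobius_denom_neq0 //.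
  exact: mobius_lt1.
apply: (le_lt_trans _ (lt1 (Ordinal n_gt0))); rewrite ler_piMr //.
by apply: prodr_ile1 => j _; rewrite normr_ge0 ltW.
Qed.

Lemma root_fibre_poly c z : disk z -> root (fibre_poly c) z = (Blaschke a z == c).
Proof.
move=> z1; rewrite rootE /fibre_poly !hornerE subr_eq0 Blaschke_hornerE.
by rewrite -[RHS](inj_eq (mulIf (den_neq0 z1))) divfK ?den_neq0.
Qed.

(** Outside the disk |q| <= |p| and p does not vanish, so p = c q is impossible
    when |c| < 1. *)
Lemma fibre_poly_disk c u : `|c| < 1 -> root (fibre_poly c) u -> disk u.
Proof.
move=> c1; rewrite rootE /fibre_poly !hornerE subr_eq0 => /eqP pu.
apply: contrapT => u1.
have qp : `|q.[u]| <= `|p.[u]|.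
  rewrite horner_num horner_den !normr_prod; apply: ler_prod => j _.
  by rewrite normr_ge0 mobius_ge1.
have p0 : 0 < `|p.[u]|.
  rewrite normr_gt0 horner_num; apply/prodf_neq0 => j _.
  by rewrite subr_eq0; apply/eqP => aju; apply: u1; rewrite -aju.
have : `|p.[u]| < `|p.[u]|.
  rewrite {1}pu normrM; apply: (le_lt_trans (ler_wpM2l _ qp)) => //.
  by rewrite gtr_pMl.
by rewrite ltxx.
Qed.

Lemma size_num_factor j : size ((a j)%:P - 'X) = 2.
Proof. by rewrite -size_polyN opprB size_XsubC. Qed.

Lemma size_den_factor j : (size (1 - (a j)^* *: 'X : {poly C})%R <= 2)%N.
Proof.
apply: (leq_trans (size_polyD _ _)); rewrite geq_max size_poly1 size_polyN /=.
by apply: (leq_trans (size_scale_leq _ _)); rewrite size_polyX.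
Qed.

Lemma size_num : size p = n.+1.
Proof.
rewrite size_prod => [|j _]; last by rewrite -size_poly_eq0 size_num_factor.
under eq_bigr do rewrite size_num_factor.
by rewrite sum_nat_const card_ord; lia.
Qed.

(** A cancellation of the leading terms of p and c q would force
    1 = |c| |a_1| ... |a_n|, which is less than 1. *)
Lemma size_fibre_poly c : `|c| < 1 -> size (fibre_poly c) = n.+1.
Proof.
move=> c1; apply/eqP; rewrite eqn_leq; apply/andP; split.
  apply: (leq_trans (size_polyD _ _)); rewrite geq_max size_num leqnn size_polyN.
  apply: (leq_trans (size_scale_leq _ _)).
  by apply: size_prod_linear => j; exact: size_den_factor.
rewrite leqNgt ltnS; apply/negP => /leq_sizeP /(_ n (leqnn _)) /eqP.
rewrite coefB coefZ !coef_prod_linear => [|j|j]; first last.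
- by rewrite size_num_factor.
- exact: size_den_factor.
rewrite subr_eq0 => /eqP /(congr1 Num.norm); rewrite normrM !normr_prod.
rewrite big1 => [|j _]; last by rewrite coefB coefC coefX sub0r normrN normr1.
move=> e; have : (1 : C) < 1; last by rewrite ltxx.
rewrite {1}e; apply: (le_lt_trans _ c1); rewrite ler_piMr //.
apply: prodr_ile1 => j _; rewrite coefB coef1 coefZ coefX mulr1 sub0r normrN.
by rewrite norm_conjC normr_ge0 ltW //; exact: ha.
Qed.

(** The zeros of p are in the disk, where q does not vanish. *)
Lemma coprimep_num_den : coprimep p q.
Proof.
apply: contraT => /closed_rootP [u]; rewrite root_gcd => /andP[pu].
have u1 : disk u.
  apply: (@fibre_poly_disk 0); rewrite ?normr0 ?ltr01 //.
  by rewrite /fibre_poly scale0r subr0.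
by rewrite rootE (negbTE (den_neq0 u1)).
Qed.

(** If p' q = p q' then p divides p' because p and q are coprime, which is
    absurd for degree reasons in characteristic 0. *)
Lemma wronskian_neq0 : blaschke_wronskian != 0.
Proof.
apply/eqP => /eqP; rewrite subr_eq0 => /eqP pq.
have p0 : p != 0 by rewrite -size_poly_eq0 size_num.
have dp0 : p^`() != 0.
  apply/eqP => /(congr1 (fun r : {poly C} => r`_n.-1)) /eqP.
  rewrite coef_deriv coef0 prednK // mulrn_eq0 (gtn_eqF n_gt0) /=.
  by rewrite -[n]/(n.+1.-1) -size_num -lead_coefE lead_coef_eq0 (negbTE p0).
have : p %| p^`() by rewrite -(Gauss_dvdpl _ coprimep_num_den) pq dvdp_mulIl.
by move/(dvdp_leq dp0); rewrite leqNgt lt_size_deriv.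
Qed.

Lemma is_derive_Blaschke z :
  disk z -> is_derive z 1 (Blaschke a) (blaschke_wronskian.[z] / q.[z] ^+ 2).
Proof.
move=> z1; have q0 := den_neq0 z1.
have -> : Blaschke a = (horner p) * (fun z => q.[z]^-1).
  by apply/funext => u; rewrite Blaschke_hornerE.
have dp := is_derive_horner p z; have dq := is_derive_horner q z.
have dV : is_derive z 1 (fun z => q.[z]^-1) (- q.[z] ^- 2 *: q^`().[z]).
  split; first exact: (@derivableV C C (horner q)).
  by rewrite (@deriveV C C (horner q)) // derive_val.
apply: is_derive_eq; rewrite /blaschke_wronskian !hornerE /=.
rewrite /GRing.scale /=.
by field.
Qed.



End BlaschkePolynomials.

(** * Fibres of a Blaschke product *)

Section Fibres.
Variables (C : numClosedFieldType) (n : nat) (a : 'I_n -> C).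
Hypothesis n_gt0 : (0 < n)%N.
Hypothesis ha : forall j, disk (a j).
Implicit Types (c u w z : C) (s : seq C).
Local Notation p := (blaschke_num a).
Local Notation q := (blaschke_den a).
Local Notation B := (Blaschke a).

Lemma fibre_poly_split c : `|c| < 1 -> exists2 s : seq C, size s = n &
  fibre_poly a c = lead_coef (fibre_poly a c) *: \prod_(x <- s) ('X - x%:P).
Proof.
move=> c1; have sP := size_fibre_poly n_gt0 ha c1.
have [s sE] := closed_field_poly_normal (fibre_poly a c); exists s => //.
have l0 : lead_coef (fibre_poly a c) != 0.
  by rewrite lead_coef_eq0 -size_poly_eq0 sP.
by apply/eqP; rewrite -eqSS -sP sE size_scale // size_prod_XsubC.
Qed.

Lemma near_den_neq0 z : disk z -> \forall u \near z, q.[u] != 0.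
Proof.
move=> z1; have := @horner_continuous C q z.
by move/cvgr_neq0; apply; exact: den_neq0.
Qed.

(** The fibre is the list of roots of p - B(z) q, with z brought to the front;
    splitting off the factors at w from this polynomial and dividing by q gives
    the order of vanishing of B - B(z) at w. *)
Lemma fibre_nonempty z : disk z -> exists s, fibre a z s.
Proof.
move=> z1; have c1 := Blaschke_lt1 n_gt0 ha z1.
have [r rn rE] := fibre_poly_split c1.
set P := fibre_poly a (B z) in rE.
have P0 : P != 0 by rewrite -size_poly_eq0 size_fibre_poly.
have rootP w : root P w = (w \in r).
  by rewrite rE rootZ ?lead_coef_eq0 // root_prod_XsubC.
have zr : z \in r by rewrite -rootP root_fibre_poly.
have rs := perm_to_rem zr; set s := z :: rem z r in rs.
exists s; split=> [||w|w w1] //; first by rewrite -(perm_size rs).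
  by rewrite -(perm_mem rs) -rootP; exact: fibre_poly_disk.
pose t := lead_coef P *: \prod_(x <- s | x != w) ('X - x%:P).
have PE : P = ('X - w%:P) ^+ count_mem w s * t.
  rewrite rE (perm_big _ rs) /= (bigID (pred1 w)) /= -scalerAr; congr (_ *: (_ * _)).
  rewrite (eq_bigr (fun _ => 'X - w%:P)) => [|x /eqP -> //].
  by rewrite big_const_seq iter_mulr_1.
have tw : t.[w] != 0.
  rewrite hornerZ mulf_neq0 ?lead_coef_eq0 //.
  rewrite horner_prod prodf_seq_neq0; apply/allP => x _ /=.
  by apply/implyP => xw; rewrite hornerXsubC subr_eq0 eq_sym.
exists (fun u => t.[u] * q.[u]^-1); first by rewrite mulf_neq0 ?invr_neq0 ?den_neq0.
clearbody t.
have nq := near_den_neq0 w1; near=> u.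
have q0 : q.[u] != 0 by near: u.
split.
  apply: (@derivableM C C (horner t) (fun u => q.[u]^-1)).
    exact: (@ex_derive _ _ _ _ _ _ _ (is_derive_horner t u)).
  apply: (@derivableV C C (horner q)) => //.
  exact: (@ex_derive _ _ _ _ _ _ _ (is_derive_horner q u)).
have e : p.[u] - B z * q.[u] = (u - w) ^+ count_mem w s * t.[u].
  by have := congr1 (horner^~ u) PE; rewrite /P /fibre_poly !hornerE.
by rewrite mulrA -e mulrBl -Blaschke_hornerE mulfK.
Unshelve. all: by end_near. Qed.

Lemma mem_fibre z s w : fibre a z s -> disk w -> (w \in s) = (B w == B z).
Proof.
case=> _ _ _ vs w1; have [h h0 /nbhs_singleton [_ Bw]] := vs w w1.
rewrite -[RHS]subr_eq0 Bw subrr -has_pred1 has_count.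
case: (count_mem w s) => [|m] /=; first by rewrite expr0 mul1r (negbTE h0).
by rewrite expr0n mul0r eqxx.
Qed.

(** A double occurrence of z would make B - B(z) divisible by (u - z)^2, and B'
    would vanish at z. *)
Lemma fibre_simple z s : disk z -> derive1 B z != 0 -> fibre a z s -> count_mem z s = 1.
Proof.
move=> z1 dB fs; have [_ _ _ vs] := fs.
have zs : z \in s by rewrite (mem_fibre fs) // eqxx.
have [h h0 hz] := vs z z1; have [dh _] := nbhs_singleton hz.
move: zs hz; rewrite -has_pred1 has_count; case: (count_mem z s) => [//|[//|m]] _ hz.
case/eqP: dB.
have ch : {for z, continuous h} by exact/differentiable_continuous/derivable1_diffP.
have -> : 0 = (z - z) ^+ m.+1 * h z by rewrite subrr expr0n mul0r.
rewrite derive1E; apply: derive_val.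
apply: (is_derive_divided_difference (k := fun u => (u - z) ^+ m.+1 * h u)).
  by near=> u; rewrite mulrA -exprS; near: u; apply: filterS hz => u [].
apply: continuousM ch.
have -> : (fun u => (u - z) ^+ m.+1) = horner (('X - z%:P) ^+ m.+1).
  by apply/funext => u; rewrite !hornerE.
exact: horner_continuous.
Unshelve. all: by end_near. Qed.

Lemma fibre_xget z : disk z -> fibre a z (xget [::] (fibre a z)).
Proof. by move=> z1; apply: xgetPex; exact: fibre_nonempty. Qed.

Lemma varphi_fibre z w : disk z -> derive1 B z != 0 ->
  [/\ disk w, w != z & B w = B z] <-> exists2 j, (1 <= j < n)%N & w = varphi a j z.
Proof.
move=> z1 dB; have fs := fibre_xget z1; rewrite /varphi.
have [sn s0 sd _] := fs; have cz := fibre_simple z1 dB fs.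
have zs : z \in xget [::] (fibre a z) by rewrite (mem_fibre fs) // eqxx.
have := mem_fibre fs.
case: (xget _ _) sn s0 sd cz zs {fs} => [//|x t] /= sn -> sd cz _ memP.
have {}cz : z \notin t.
  by rewrite -has_pred1 has_count -leqNgt; move: cz; rewrite eqxx add1n => -[->].
split=> [[w1 wz Bw]|[[//|j] /= jn wj]].
  have wt : w \in t by have := memP w w1; rewrite Bw eqxx in_cons (negbTE wz).
  exists (index w t).+1; last by rewrite /= nth_index.
  by rewrite -sn /= ltnS index_mem.
have wt : w \in t by rewrite wj mem_nth // -ltnS sn.
have w1 : disk w by apply: sd; rewrite in_cons wt orbT.
split=> //; first by apply: contraNneq cz => <-.
by apply/eqP; rewrite -memP // in_cons wt orbT.
Qed.

(** No denominator vanishes, since varphi_j(z) != z for j >= 1; so a zero of the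
    product is a zero of a numerator. *)
Lemma Gamma_prod_eq0 (g : C -> C) z : disk z -> derive1 B z != 0 ->
  Gamma_prod a g z = 0 <-> exists w, [/\ disk w, w != z, B w = B z & g w = g z].
Proof.
move=> z1 dB; have vP := varphi_fibre _ z1 dB; split=> [/eqP|[w [w1 wz Bw gw]]].
  rewrite /Gamma_prod prodf_seq_eq0 => /hasP [j]; rewrite mem_index_iota => jn /=.
  have [v1 vz Bv] : [/\ disk (varphi a j z), varphi a j z != z &
    B (varphi a j z) = B z] by apply/vP; exists j.
  rewrite mulf_eq0 invr_eq0 !subr_eq0 [z == _]eq_sym (negbTE vz) orbF => /eqP gv.
  by exists (varphi a j z).
have [j jn wj] : exists2 j, (1 <= j < n)%N & w = varphi a j z by apply/vP.
apply/eqP; rewrite /Gamma_prod prodf_seq_eq0; apply/hasP; exists j.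
  by rewrite mem_index_iota.
by rewrite /= -wj gw subrr mul0r.
Qed.

Lemma derive1_Blaschke_eq0 z : disk z ->
  (derive1 B z == 0) = ((blaschke_wronskian a).[z] == 0).
Proof.
move=> z1; have dB := is_derive_Blaschke ha z1.
rewrite derive1E derive_val mulf_eq0 invr_eq0 expf_eq0 /=.
by rewrite (negbTE (den_neq0 ha z1)) orbF.
Qed.

Lemma finite_critical : finite_set [set z | disk z /\ derive1 B z = 0].
Proof.
have [s sE] := closed_field_poly_normal (blaschke_wronskian a).
apply: (sub_finite_set (B := [set` s])); last exact: finite_seq.
move=> z [z1 /eqP]; rewrite derive1_Blaschke_eq0 // -rootE sE.
by rewrite rootZ ?lead_coef_eq0 ?wronskian_neq0 // root_prod_XsubC.
Qed.

Lemma finite_fibre c : `|c| < 1 -> finite_set [set z | disk z /\ B z = c].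
Proof.
move=> c1; have [s _ sE] := fibre_poly_split c1.
apply: (sub_finite_set (B := [set` s])); last exact: finite_seq.
move=> z [z1 /eqP]; rewrite -root_fibre_poly // sE rootZ ?root_prod_XsubC //.
by rewrite lead_coef_eq0 -size_poly_eq0 size_fibre_poly.
Qed.

(** By divided differences p(u) q(v) - p(v) q(u) = (u - v) K(u, v), where K is
    continuous and K(z, z) is the numerator of B'(z). *)
Lemma Blaschke_locally_injective z : disk z -> derive1 B z != 0 ->
  \forall u \near z & v \near z, B u = B v -> u = v.
Proof.
move=> z1; rewrite derive1_Blaschke_eq0 // => Wz.
have [Kp [pE pd pc]] := poly_divided_difference p.
have [Kq [qE qd qc]] := poly_divided_difference q.
pose K (x : C * C) := Kp x.1 x.2 * q.[x.2] - p.[x.2] * Kq x.1 x.2.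
have cK : continuous K.
  have -> : K = ((fun x => Kp x.1 x.2) \* (horner q \o snd)) +
      ((\- (horner p \o snd)) \* (fun x => Kq x.1 x.2)).
    by apply/funext => x; rewrite /K -mulNr.
  have c2 (r : {poly C}) : continuous (horner r \o (snd : C * C -> C)).
    by move=> x; apply: continuous_comp; [exact: cvg_snd|exact: horner_continuous].
  move=> x; apply: continuousD; apply: continuousM; [exact: pc|exact: c2| |exact: qc].
  by apply: continuousN; exact: c2.
have Kz : K (z, z) != 0.
  by rewrite /K /= pd qd; move: Wz; rewrite /blaschke_wronskian !hornerE.
have nK : \forall x \near (z, z), K x != 0 by exact: (cvgr_neq0 _ (cK _)).
have nq := near_den_neq0 z1.
have nqq : \forall u \near z & v \near z, q.[u] != 0 /\ q.[v] != 0.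
  by exists ([set u | q.[u] != 0], [set u | q.[u] != 0]).
apply: filterS2 nK nqq => -[u v] /= K0 [qu qv].
rewrite !Blaschke_hornerE => /eqP; rewrite eqr_div // => /eqP Buv.
have : (u - v) * K (u, v) = 0.
  have -> : (u - v) * K (u, v) =
      (u - v) * Kp u v * q.[v] - p.[v] * ((u - v) * Kq u v) by rewrite /K /=; ring.
  by rewrite -pE -qE mulrBl mulrBr Buv subrr.
by move/eqP; rewrite mulf_eq0 (negbTE K0) orbF subr_eq0 => /eqP.
Qed.

End Fibres.

(** * Continuous dependence of the fibre *)

Section RootContinuity.
Variables (C : numClosedFieldType) (n : nat) (a : 'I_n -> C).
Hypothesis n_gt0 : (0 < n)%N.
Hypothesis ha : forall j, disk (a j).
Implicit Types (c u w z d : C) (s : seq C).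
Local Notation q := (blaschke_den a).
Local Notation B := (Blaschke a).

Lemma Blaschke_continuous z : disk z -> {for z, continuous B}.
Proof.
move=> z1; apply/differentiable_continuous/derivable1_diffP.
by have [] := is_derive_Blaschke ha z1.
Qed.

(** Let P = p - B(z0) q, with roots x_1, ..., x_n and leading coefficient l.  If
    B(u) = B(z) then P(u) = (B(z) - B(z0)) q(u), so |l| |u - x_1| ... |u - x_n|
    is at most 2^n |B(z) - B(z0)|: when z is close to z0, the distances from u to
    the roots cannot all be at least d. *)
Lemma fibre_continuity z0 d : disk z0 -> 0 < d ->
  \forall z \near z0, forall u, disk u -> B u = B z ->
    exists w, [/\ disk w, B w = B z0 & `|u - w| < d].
Proof.
move=> z01 d0; have c1 := Blaschke_lt1 n_gt0 ha z01.
have [s sn sE] := fibre_poly_split n_gt0 ha c1.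
set P := fibre_poly a (B z0) in sE; set l := lead_coef P in sE.
have l0 : l != 0 by rewrite lead_coef_eq0 -size_poly_eq0 size_fibre_poly.
have e0 : 0 < `|l| * d ^+ n / 2 ^+ n.
  by rewrite divr_gt0 ?exprn_gt0 // mulr_gt0 ?normr_gt0 ?exprn_gt0.
have := Blaschke_continuous z01; move/cvgrPdist_lt => /(_ _ e0).
apply: filterS => z zz0 u u1 Bu.
have Pu : P.[u] = (B z - B z0) * q.[u].
  rewrite /P /fibre_poly !hornerE -Bu (Blaschke_hornerE a u) mulrBl.
  by rewrite divfK ?den_neq0.
have qu : `|q.[u]| <= 2 ^+ n.
  rewrite horner_den normr_prod -[n in leRHS]card_ord -prodr_const.
  apply: ler_prod => j _; rewrite normr_ge0 /=.
  apply: (le_trans (ler_normB _ _)); rewrite normr1 -[2]/(1 + 1) lerD2l.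
  by rewrite normrM norm_conjC mulr_ile1 ?normr_ge0 // ltW //; exact: ha.
have [/hasP [x xs xd]|/hasPn far] := boolP (has (fun x => `|u - x| < d) s).
  have rx : root P x by rewrite sE rootZ // root_prod_XsubC.
  have x1 : disk x := fibre_poly_disk ha c1 rx.
  by exists x; split=> //; apply/eqP; rewrite -(root_fibre_poly ha).
have : `|P.[u]| < `|P.[u]|; last by rewrite ltxx.
rewrite {1}Pu normrM; apply: (@lt_le_trans _ _ (`|l| * d ^+ n)).
  have n2 : 2 ^+ n != 0 :> C by rewrite expf_neq0.
  rewrite -[ltRHS](divfK n2).
  rewrite distrC; apply: (le_lt_trans (ler_wpM2l _ qu)) => //.
  by rewrite ltr_pM2r ?exprn_gt0.
rewrite sE hornerZ normrM ler_wpM2l // horner_prod normr_prod -sn.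
have -> : d ^+ size s = \prod_(x <- s) d.
  by rewrite big_const_seq count_predT iter_mulr_1.
rewrite big_seq [leRHS]big_seq; apply: ler_prod => x xs.
rewrite (ltW d0) hornerXsubC /= real_leNgt ?far //; last by rewrite gtr0_real.
Qed.

(** Makes uniform in x the neighbourhoods of the points (x, z0), for finitely
    many x. *)
Lemma uniform_radius_seq (R : C -> C -> Prop) s z0 :
  (forall x, x \in s -> \forall u \near x & z \near z0, R u z) ->
  exists2 d : C, 0 < d &
    \forall z \near z0, forall x u, x \in s -> `|u - x| < d -> R u z.
Proof.
elim: s => [|x s IHs] sR; first by exists 1 => //; near=> z.
have [|d d0 hd] := IHs; first by move=> y ys; apply: sR; rewrite in_cons ys orbT.
have [[U V] /= [/nbhs_ballP [e e0 eU] zV] UV] := sR x (mem_head _ _).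
(* The order on the field is partial: d and e are comparable as positive elements. *)
pose m := if d <= e then d else e.
have [m0 md me] : [/\ 0 < m, m <= d & m <= e].
  rewrite /m; have := @real_leP _ d e (gtr0_real d0) (gtr0_real e0).
  by case=> de; split=> //; exact: ltW.
exists m => //; apply: filterS2 hd zV => z hz Vz y u; rewrite in_cons.
case/orP=> [/eqP -> um|ys um]; last by apply: (hz y) => //; exact: lt_le_trans md.
apply: (UV (u, z)); split=> //=; apply: eU.
by rewrite /ball /= distrC; exact: lt_le_trans me.
Unshelve. all: by end_near. Qed.

(** The points of the fibre of z close to z0 are excluded by local injectivity,
    the others by continuity of g; by continuity of the fibre there are no more. *)
Lemma separated_fibre_near (g : C -> C) z0 :
  (forall z, disk z -> {for z, continuous g}) -> disk z0 -> derive1 B z0 != 0 ->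
  (forall w, disk w -> B w = B z0 -> g w = g z0 -> w = z0) ->
  \forall z \near z0, forall w, disk w -> B w = B z -> g w = g z -> w = z.
Proof.
move=> cg z01 dB sep.
have [s fs] := fibre_nonempty n_gt0 ha z01; have [_ _ sd _] := fs.
have loc x : x \in s ->
    \forall u \near x & z \near z0, B u = B z -> g u = g z -> u = z.
  move=> xs; have x1 := sd x xs; have [->|xz] := eqVneq x z0.
    by apply: filterS (Blaschke_locally_injective ha z01 dB) => -[u v] /= h + _.
  have gx : g x != g z0.
    apply: contraNneq xz => gx; apply/eqP/sep => //; apply/eqP.
    by rewrite -(mem_fibre fs).
  have cgg : {for (x, z0), continuous (fun y => g y.1 - g y.2)}.
    have -> : (fun y => g y.1 - g y.2) = (g \o fst) - (g \o snd) :> (C * C -> C).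
      exact/funext.
    apply: continuousB; apply: continuous_comp; [exact: cvg_fst|exact: cg| |exact: cg].
    exact: cvg_snd.
  have nz : g x - g z0 != 0 by rewrite subr_eq0.
  apply: filterS (cvgr_neq0 _ cgg nz) => -[u v] /= guv _ e.
  by rewrite e subrr eqxx in guv.
have [d d0 tube] := uniform_radius_seq loc.
apply: filterS2 tube (fibre_continuity z01 d0) => z hz near_s w w1 Bw gw.
have [x [x1 Bx wx]] := near_s w w1 Bw.
by apply: (hz x w) => //; rewrite (mem_fibre fs) // Bx.
Qed.

End RootContinuity.

(** * Countability in the complex plane *)

Section ComplexPlane.
Variable R : realType.
Local Notation C := (Cplx R).
Implicit Types (z : C) (A : set C).
Local Open Scope complex_scope.

Lemma gt0_real_part (e : C) : 0 < e -> exists2 r : R, 0 < r & e = r%:C.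
Proof.
case: e => x y; rewrite ltcE /= => /andP[/eqP -> x0]; by exists x.
Qed.

Lemma rational_near z (e : C) : 0 < e -> exists q : rat * rat,
  `|z - ((ratr q.1 : R) +i* (ratr q.2 : R) : C)| < e.
Proof.
move=> /gt0_real_part [r r0 ->]; have r2 : 0 < r / 2 by rewrite divr_gt0.
case: z => x y.
have near_rat (t : R) : exists q : rat, `|t - ratr q| < r / 2.
  have /rat_in_itvoo [q] : t - r / 2 < t + r / 2 by lra.
  by rewrite in_itv /= => /andP[? ?]; exists q; rewrite ltr_norml; lra.
have [q1 h1] := near_rat x; have [q2 h2] := near_rat y.
exists (q1, q2) => /=.
have -> : (x +i* y : C) - (ratr q1 +i* ratr q2) =
    (x - ratr q1)%:C + 'i%C * (y - ratr q2)%:C.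
  by apply/eqP; rewrite eq_complex /=; apply/andP; split; apply/eqP; ring.
apply: (le_lt_trans (ler_normD _ _)); rewrite normrM.
rewrite !normc_def /= !expr0n expr1n !addr0 add0r !sqrtr_sqr sqrtr1 mul1r.
rewrite -rmorphD ltcR; lra.
Qed.

(** Choose around each point x of A a radius e(x) isolating it, and a rational
    point within e(x) / 2 of x.  Two points of A with the same rational point are
    at distance less than the larger of their radii, hence equal. *)
Lemma discrete_countable A : A `<=` isolated A -> countable A.
Proof.
move=> dA.
have [e eP] : {e : C -> C & forall x, A x -> 0 < e x /\
    forall y, A y -> `|x - y| < e x -> y = x}.
  apply: (@choice _ _ (fun x e => A x -> 0 < e /\ forall y, A y -> `|x - y| < e -> y = x)).
  move=> x; have [Ax|nAx] := pselect (A x); last by exists 0.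
  have [_ [V /nbhs_ballP [d /= d0 dV] VA]] := dA x Ax.
  exists d => _; split=> // y Ay xy; suff : [set x] y by [].
  by rewrite -VA; split=> //; apply: dV.
have [f fP] : {f : C -> rat * rat & forall x, A x ->
    `|x - ((ratr (f x).1 : R) +i* (ratr (f x).2 : R) : C)| < e x / 2}.
  apply: (@choice _ _ (fun x (q : rat * rat) => A x ->
    `|x - ((ratr q.1 : R) +i* (ratr q.2 : R) : C)| < e x / 2)).
  move=> x; have [Ax|nAx] := pselect (A x); last by exists 0.
  have [q hq] := @rational_near x (e x / 2) (divr_gt0 (eP x Ax).1 (ltr0Sn _ 1)).
  by exists q.
apply: (@sub_countable _ _ A [set: rat * rat]); last exact: countableP.
have fI : {in A &, injective f}.
  suff le_inj x y : A x -> A y -> f x = f y -> e x <= e y -> x = y.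
    move=> x y /set_mem Ax /set_mem Ay fxy.
    have [ex _] := eP x Ax; have [ey _] := eP y Ay.
    case: (real_leP (gtr0_real ex) (gtr0_real ey)) => [|/ltW]; first exact: le_inj.
    by move=> /le_inj h; apply/esym/h.
  move=> Ax Ay fxy exy; apply: (eP y Ay).2 => //.
  have := fP x Ax; rewrite fxy; set q : C := _ +i* _ => xq.
  rewrite -(subrKA q) (splitr (e y)); apply: (le_lt_trans (ler_normD _ _)).
  apply: ltrD; first exact: fP.
  by rewrite distrC (lt_le_trans xq) // ler_wpM2r // invr_ge0.
rewrite -(card_le_eql (inj_card_eq fI)); exact: subset_card_le.
Qed.

(** A neighbourhood contains a real segment, whose Lebesgue measure is positive. *)
Lemma nbhs_not_countable z (V N : set C) :
  nbhs z V -> countable N -> exists2 w, V w & ~ N w.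
Proof.
move=> /nbhs_ballP [e /= /gt0_real_part [r r0 ->] eV] cN; apply: contrapT => VN.
pose f (t : R) : C := z + t%:C.
have fI : {in `]0, r[%classic &, injective f}.
  by move=> s t _ _ /addrI /complexI.
have fV : f @` `]0, r[%classic `<=` N.
  move=> _ [t t0r <-]; have /andP[t0 tr] : 0 < t < r by move: t0r; rewrite /= in_itv.
  apply: contrapT => nN; apply: VN; exists (f t) => //; apply: eV.
  rewrite /ball /= /f opprD addNKr normrN.
  by rewrite normc_def /= expr0n addr0 sqrtr_sqr ltcR gtr0_norm.
have : countable (`]0, r[%classic : set R).
  by rewrite -(eq_countable (inj_card_eq fI));
    exact: sub_countable (subset_card_le fV) cN.
move/countable_lebesgue_measure0; rewrite lebesgue_measure_itv /= lte_fin r0.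
by rewrite oppr0 adde0 => -[] /eqP; rewrite gt_eqF.
Qed.

End ComplexPlane.

(** * Self-maps of the disk with prescribed fibres *)

Lemma card_ge2P (T : pointedType) (X : set T) :
  (`I_2 #<= X)%card <-> exists x y, [/\ X x, X y & x != y].
Proof.
split=> [/pcard_leP [f]|[x [y [Xx Xy xy]]]].
  exists (f 0%N), (f 1%N); split; [exact: funS|exact: funS|].
  by apply/eqP => /inj; rewrite !inE => /(_ isT isT).
pose f (i : nat) := if i == 0%N then x else y.
have fI : {in `I_2 &, injective f}.
  move=> [|[|i]] [|[|j]] /set_mem // _ /set_mem // _; rewrite /f /= => e //;
    by rewrite e eqxx in xy.
rewrite -(card_le_eql (inj_card_eq fI)); apply: subset_card_le.
by move=> _ [i _ <-]; rewrite /f; case: ifP.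
Qed.

(** A set of representatives of the classes of F in D lies in D, and it is at
    least as large as N, on which F is injective, hence as D.  Cantor-Bernstein
    gives a bijection from the representatives to D, to be applied after the choice
    of representatives. *)
Lemma fibres_of_selfmap (T : pointedType) (U : Type) (D N : set T) (F : T -> U) :
  N `<=` D -> (D #<= N)%card -> {in N &, injective F} ->
  exists phi : T -> T, [/\ forall z, D z -> D (phi z),
    forall y, D y -> exists2 z, D z & phi z = y
    & forall z w, D z -> D w -> (phi z = phi w <-> F z = F w)].
Proof.
move=> ND DN FN; pose rep z := xget point [set w | D w /\ F w = F z].
have repP z : D z -> D (rep z) /\ F (rep z) = F z.
  by move=> Dz; apply: (@xgetPex _ point [set w | D w /\ F w = F z]); exists z.
have repE z w : D z -> D w -> rep z = rep w <-> F z = F w.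
  move=> /repP[_ Fz] /repP[_ Fw]; split=> [e|e]; last by rewrite /rep e.
  by rewrite -Fz e Fw.
have repI : {in N &, injective rep}.
  by move=> z w /[!inE] Nz Nw /(repE _ _ (ND _ Nz) (ND _ Nw)); apply: FN; rewrite inE.
have /card_set_bijP [psi [psiD psiI psiS]] : (rep @` D #= D)%card.
  apply: Cantor_Bernstein; first by apply: subset_card_le => _ [z /repP[? _] <-].
  apply: card_le_trans DN _; rewrite -(card_le_eql (inj_card_eq repI)).
  by apply: subset_card_le; exact: image_subset.
exists (psi \o rep); split=> [z Dz|y /psiS [_ [z Dz <-]]|z w Dz Dw] /=.
- by apply: psiD; exists z.
- by exists z.
- rewrite -repE //; split=> [|-> //]; apply: psiI; rewrite inE.
  + by exists z.
  + by exists w.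
Qed.

Lemma finite_set_discrete (T : topologicalType) (A : set T) :
  accessible_space T -> finite_set A -> A `<=` isolated A.
Proof.
move=> hT fA x Ax; split; first exact/mem_set.
exists (~` (A `\ x)).
  apply: open_nbhs_nbhs; split; last by move=> [_]; exact.
  apply: closed_openC; apply: (@accessible_finite_set_closed T).1 => //.
  exact: finite_setD.
apply/seteqP; split=> [y [nAy Ay]|_ ->]; last by split=> // -[_]; exact.
by apply: contrapT => yx; apply: nAy.
Qed.

Lemma open_disk (C : numClosedFieldType) : open (@disk C).
Proof.
have -> : @disk C = ball (0 : C) 1.
  by apply/seteqP; split=> z; rewrite /disk /ball /= sub0r normrN.
exact: ball_open.
Qed.

Lemma card_disk_le_nbhs (C : numClosedFieldType) (z : C) (V : set C) :
  nbhs z V -> (@disk C #<= V)%card.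
Proof.
move=> /nbhs_ballP [e /= e0 eV]; pose f (w : C) := z + e * w.
have fI : {in @disk C &, injective f}.
  by move=> u v _ _ /addrI /mulfI; apply; rewrite gt_eqF.
rewrite -(card_le_eql (inj_card_eq fI)); apply: subset_card_le.
move=> _ [w w1 <-]; apply: eV; rewrite /ball /= /f opprD addNKr normrN normrM.
by rewrite gtr0_norm // gtr_pMr.
Qed.

(** * Twins and the vanishing of Gamma *)

Section GammaZero.
Variables (R : realType) (n : nat) (a : 'I_n -> Cplx R).
Hypothesis n_gt0 : (0 < n)%N.
Hypothesis ha : forall j, disk (a j).
Local Notation C := (Cplx R).
Local Notation B := (Blaschke a).
Variable g : C -> C.

Definition has_twin z := exists w, [/\ disk w, w != z, B w = B z & g w = g z].

Lemma Gamma_noncritical z : disk z -> derive1 B z != 0 ->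
  Gamma a g z = 0 <-> has_twin z.
Proof. by move=> z1 dB; rewrite /Gamma dB; exact: Gamma_prod_eq0. Qed.

(** A point of the disk with only one preimage by phi is the image of a point
    without twin, hence of a critical point. *)
Lemma collapse_of_twins :
  (forall z, disk z -> derive1 B z != 0 -> has_twin z) ->
  exists (phi : C -> C) (A : set C),
    [/\ forall z, disk z -> disk (phi z),
        discrete_subset disk A,
        forall z, (disk `\` A) z -> (`I_2 #<= [set w | disk w /\ phi w = z])%card
      & exists B1 g1 : C -> C, forall z, disk z -> B z = B1 (phi z) /\ g z = g1 (phi z)].
Proof.
move=> twin; pose crit : set C := [set z | disk z /\ derive1 B z = 0].
have fcrit : finite_set crit by exact: finite_critical.
have [z0 z01 dB] : exists2 z, disk z & derive1 B z != 0.
  have d0 : nbhs (0 : C) disk.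
    by apply: open_nbhs_nbhs; split; [exact: open_disk|rewrite /disk /= normr0].
  have [z z1 nz] := nbhs_not_countable d0 (finite_set_countable fcrit).
  by exists z => //; apply/eqP => dB; apply: nz.
have [[U V] /= [Uz Vz] UV] := Blaschke_locally_injective ha z01 dB.
(* B is injective on N, so (B, g) has as many classes as N has points. *)
pose N := (U `&` V) `&` @disk C.
have nN : nbhs z0 N.
  by apply: filterI; [exact: filterI|apply: open_nbhs_nbhs; split; [exact: open_disk|]].
have NF : {in N &, injective (fun z => (B z, g z))}.
  by move=> u v /set_mem [[Uu _] _] /set_mem [[_ Vv] _] [Buv _]; exact: (UV (u, v)).
have [phi [phi_disk phi_onto phiE]] :=
  fibres_of_selfmap (@subIsetr _ _ _) (card_disk_le_nbhs nN) NF.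
exists phi, (phi @` crit); split=> //.
- split; first by move=> _ [z [z1 _] <-]; exact: phi_disk.
  apply: finite_set_discrete; last exact: finite_image.
  exact/hausdorff_accessible/norm_hausdorff.
- move=> y [y1 nAy]; have [z z1 zy] := phi_onto y y1.
  have [|w [w1 wz Bw gw]] := twin z z1.
    by apply: contra_notN nAy => /eqP dBz; exists z.
  apply: (@card_ge2P C _).2; exists w, z; split=> //; split=> //.
  by rewrite -zy; apply/phiE => //; rewrite Bw gw.
- have [sec secP] : {sec : C -> C & forall y, disk y -> disk (sec y) /\ phi (sec y) = y}.
    apply: (@choice _ _ (fun y z => disk y -> disk z /\ phi z = y)) => y.
    have [y1|] := pselect (disk y); last by exists 0.
    by have [z z1 zy] := phi_onto y y1; exists z.
  exists (B \o sec), (g \o sec) => z z1 /=.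
  have [s1 sE] := secP _ (phi_disk z z1).
  by have /(phiE _ _ s1 z1) [-> ->] := sE.
Qed.

(** A point without twin is the only preimage of its image by phi, so it lies in
    the preimage of A.  This preimage is a countable union of fibres of phi, each
    contained in a fibre of B and therefore finite. *)
Lemma countable_twinless (phi : C -> C) (A : set C) (B1 g1 : C -> C) :
  A `<=` isolated A ->
  (forall z, disk z -> disk (phi z)) ->
  (forall z, (disk `\` A) z -> (`I_2 #<= [set w | disk w /\ phi w = z])%card) ->
  (forall z, disk z -> B z = B1 (phi z) /\ g z = g1 (phi z)) ->
  countable [set z | disk z /\ ~ has_twin z].
Proof.
move=> dA phi_disk phi2 BgE.
pose N := \bigcup_(y in A) [set w | disk w /\ phi w = y].
have cN : countable N.
  apply: bigcup_countable; first exact: discrete_countable.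
  move=> y _; apply: finite_set_countable.
  have [->|/set0P [w0 [w01 w0y]]] := eqVneq [set w | disk w /\ phi w = y] set0.
    exact: finite_set0.
  apply: sub_finite_set (finite_fibre n_gt0 ha (Blaschke_lt1 n_gt0 ha w01)).
  move=> w [w1 wy]; split=> //.
  by rewrite (BgE w w1).1 (BgE w0 w01).1 wy w0y.
apply: (sub_countable (subset_card_le _) cN) => z [z1 nz].
apply: contrapT => nN; apply: nz.
have /(@card_ge2P C _).1 [x [y [[x1 xz] [y1 yz] xy]]] :
    (`I_2 #<= [set w | disk w /\ phi w = phi z])%card.
  by apply: phi2; split; [exact: phi_disk|move=> Az; apply: nN; exists (phi z)].
have [w [w1 wphi wz]] : exists w, [/\ disk w, phi w = phi z & w != z].
  have [xz'|xz'] := eqVneq x z; last by exists x.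
  by exists y; split=> //; rewrite -xz' eq_sym.
exists w; split=> //.
  by rewrite (BgE w w1).1 (BgE z z1).1 wphi.
by rewrite (BgE w w1).2 (BgE z z1).2 wphi.
Qed.

Lemma twin_of_countable_twinless :
  (forall z, disk z -> {for z, continuous g}) ->
  countable [set z | disk z /\ ~ has_twin z] ->
  forall z, disk z -> derive1 B z != 0 -> has_twin z.
Proof.
move=> cg cT z z1 dB; apply: contrapT => nz.
have sep w : disk w -> B w = B z -> g w = g z -> w = z.
  by move=> w1 Bw gw; apply/eqP/negP => /negP wz; apply: nz; exists w.
have near_sep := separated_fibre_near n_gt0 ha cg z1 dB sep.
have near_disk : \forall u \near z, disk u.
  by apply: open_nbhs_nbhs; split; [exact: open_disk|].
have [u [u1 su] []] := nbhs_not_countable (filterI near_disk near_sep) cT.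
by split=> // -[w [w1 wu Bw gw]]; move/eqP: wu; apply; exact: su.
Qed.

(** Near a critical point there is no other one, so the limit defining Gamma is
    taken along zeros. *)
Lemma Gamma_critical z : disk z -> derive1 B z = 0 ->
  (forall w, disk w -> derive1 B w != 0 -> has_twin w) -> Gamma a g z = 0.
Proof.
move=> z1 dB twin; rewrite /Gamma dB eqxx /=; apply: (@lim_near_cst C).
  exact: norm_hausdorff.
have closed_crit : closed ([set w | disk w /\ derive1 B w = 0] `\ z).
  apply: (@accessible_finite_set_closed C).1; last exact/finite_setD/finite_critical.
  exact/hausdorff_accessible/norm_hausdorff.
have near_disk : \forall u \near z, disk u.
  by apply: open_nbhs_nbhs; split; [exact: open_disk|].
have near_reg : \forall u \near z, u != z -> derive1 B u != 0.
  have : nbhs z (~` ([set w | disk w /\ derive1 B w = 0] `\ z)).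
    apply: open_nbhs_nbhs; split; first exact: closed_openC.
    by move=> [_]; exact.
  apply: filterS2 near_disk => u u1 nu uz; apply/eqP => dBu.
  by apply: nu; split=> //; exact/eqP.
apply: filterS2 near_disk near_reg => u u1 ru uz.
by apply/Gamma_prod_eq0 => //; [exact: ru|apply: twin => //; exact: ru].
Qed.

End GammaZero.

Theorem theoremD (R : realType) (n : nat) (hn : (2 <= n)%N)
    (a : 'I_n -> Cplx R) (ha : forall j : 'I_n, disk (a j))
    (g : Cplx R -> Cplx R) (hg : Hinfty g) :
  (forall z : Cplx R, disk z -> Gamma a g z = 0) <->
  (exists (phi : Cplx R -> Cplx R) (A : set (Cplx R)),
    [/\ forall z : Cplx R, disk z -> disk (phi z),
        discrete_subset disk A,
        forall z : Cplx R, (disk `\` A) z ->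
          (`I_2 #<= [set w | disk w /\ phi w = z])%card
      & exists B1 g1 : Cplx R -> Cplx R,
          forall z : Cplx R, disk z ->
            Blaschke a z = B1 (phi z) /\ g z = g1 (phi z)]).
Proof.
have n_gt0 : (0 < n)%N by exact: ltnW.
split=> [Gamma0|[phi [A [phi_disk [_ dA] phi2 [B1 [g1 BgE]]]]]].
  apply: collapse_of_twins => // z z1 dB.
  by apply/(Gamma_noncritical n_gt0 ha g z1 dB); exact: Gamma0.
have cg z : disk z -> {for z, continuous g}.
  by move=> z1; apply/differentiable_continuous/derivable1_diffP; exact: hg.1.
have cT := countable_twinless n_gt0 ha dA phi_disk phi2 BgE.
have twin := twin_of_countable_twinless n_gt0 ha cg cT.
move=> z z1; have [dB|dB] := eqVneq (derive1 (Blaschke a) z) 0.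
  exact: Gamma_critical.
by apply/Gamma_noncritical => //; exact: twin.
Qed.
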